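(* Let $X$ be reflexive and separable, and let $\bar x\in\mathcal F$ be a feasible point of the constraint system $x\in C$, $G(x)\in K$ which is s-AKKT regular. Furthermore, assume that for all sequences $\{x^k\}\subset C$ and all $x\in C$ the following implication holds: $$x^k\rightharpoonup x\quad\text{and}\quad d_K(G(x^k))\to 0\quad\Longrightarrow\quad G(x)\in K .$$ Then Guignard's constraint qualification is valid at $\bar x$, i.e., $\mathcal T^w_{\mathcal F}(\bar x)^\circ=\mathcal M(\bar x,0)$.
   Context: Setting: $X$ and $Y$ are real Banach spaces, $G\colon X\to Y$ is continuously Fréchet differentiable, $C\subset X$ and $K\subset Y$ are nonempty, closed, convex sets, and $\mathcal F:=\{x\in C\mid G(x)\in K\}$. $d_K(y)=\inf_{z\in K}\|y-z\|_Y$; $\rightharpoonup$ denotes weak convergence. The weak tangent cone $\mathcal T^w_{\mathcal F}(\bar x)$ is the set of all $d\in X$ for which there exist $\{x^k\}\subset\mathcal F$ and $t^k>0$, $t^k\to0$, with $x^k\to\bar x$ (strongly) and $(x^k-\bar x)/t^k\rightharpoonup d$ (weakly). For $A\subset X$, the polar cone is $A^\circ:=\{v\in X^*\mid\langle v,x\rangle_X\le0\ \forall x\in A\}$. $\mathcal N_C(x):=\{v\in X^*\mid\langle v,z-x\rangle_X\le0\ \forall z\in C\}$ for $x\in C$ and $\mathcal N_C(x):=\varnothing$ for $x\notin C$. For $x\in X$ and $r\ge0$ let $$\mathcal M(x,r):=\{G'(x)^*\lambda+\mu\in X^*\mid \lambda\in Y^*,\ \mu\in\mathcal N_C(x),\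 \langle\lambda,y-G(x)\rangle_Y\le r\ \forall y\in K\}.$$ A point $\bar x\in\mathcal F$ is s-AKKT regular if every $\bar v\in X^*$ for which there exist sequences $\{x^k\}\subset X$, $\{r^k\}\subset[0,+\infty)$, $\{v^k\}\subset X^*$ with $x^k\to\bar x$, $r^k\to0$, $v^k\to\bar v$ (all strongly) and $v^k\in\mathcal M(x^k,r^k)$ for all $k$ belongs to $\mathcal M(\bar x,0)$. *)

(* Defs.v *)
From HB Require Import structures.
From mathcomp Require Import all_boot all_order all_algebra.
From mathcomp Require Import all_classical all_reals all_analysis.

Set Implicit Arguments.
Unset Strict Implicit.
Unset Printing Implicit Defensive.

Import Order.TTheory GRing.Theory Num.Theory.
Import numFieldNormedType.Exports.

Local Open Scope classical_set_scope.
Local Open Scope ring_scope.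

Section ContinuousLinear.
Context {R : realType} (V W : normedModType R).

Definition clin_pred : {pred V -> W} :=
  mem [set f : V -> W | linear f /\ continuous f].

Record clin := Clin { clin_fun :> V -> W; clinP : clin_fun \in clin_pred }.

HB.instance Definition _ := [isSub for clin_fun].
HB.instance Definition _ := [Choice of clin by <:].

Lemma clin_submod_closed : submod_closed clin_pred.
Proof.
split=> [|a f g].
  rewrite inE; split=> [a x y|x]; last exact: cvg_cst.
  by rewrite /GRing.zero /= scaler0 addr0.
rewrite !inE => -[lf cf] [lg cg]; split=> [b x y|x].
  change (a *: f (b *: x + y) + g (b *: x + y) =
          b *: (a *: f x + g x) + (a *: f y + g y)).
  rewrite lf lg !scalerDr !scalerA (mulrC b a) -!addrA; congr (_ + _).
  by rewrite addrCA.
by apply: cvgD; [apply: cvgZl_tmp; exact: cf | exact: cg].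
Qed.

HB.instance Definition _ :=
  GRing.isSubmodClosed.Build R (V -> W) clin_pred clin_submod_closed.
HB.instance Definition _ := [SubChoice_isSubLmodule of clin by <:].

Lemma clin_eqP (f g : clin) : f = g <-> f =1 g.
Proof. by split=> [->//|fg]; exact/val_inj/funext. Qed.

Lemma clin_linear (f : clin) : linear f.
Proof. by have := clinP f; rewrite inE => -[]. Qed.

Lemma clin_continuous (f : clin) : continuous f.
Proof. by have := clinP f; rewrite inE => -[]. Qed.

HB.instance Definition _ (f : clin) :=
  GRing.isLinear.Build R V W *:%R f (clin_linear f).

Lemma clinDE (f g : clin) x : (f + g) x = f x + g x. Proof. by []. Qed.

Lemma clinZE a (f : clin) x : (a *: f) x = a *: f x. Proof. by []. Qed.

Lemma clin0E x : (0 : clin) x = 0. Proof. by []. Qed.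

Definition opnorm (f : clin) : R := sup [set `|f x| | x in [set x | `|x| <= 1]].

Lemma opnorm_has_sup (f : clin) :
  has_sup [set `|f x| | x in [set x | `|x| <= 1]].
Proof.
split; first by exists `|f 0|; exists 0 => //=; rewrite normr0.
have /linear_boundedP/pinfty_ex_gt0[r r0 rf] :=
  continuous_linear_bounded 0 (@clin_continuous f 0).
exists r => _ [x /= x1 <-]; rewrite (le_trans (rf x))//.
by rewrite ger_pMr.
Qed.

Lemma opnorm_ge0 (f : clin) : 0 <= opnorm f.
Proof.
apply: le_trans (normr_ge0 (f 0)) _.
apply: sup_upper_bound; first exact: opnorm_has_sup.
by exists 0 => //=; rewrite normr0.
Qed.

Lemma opnormP (f : clin) x : `|f x| <= opnorm f * `|x|.
Proof.
have [->|x0] := eqVneq x 0; first by rewrite linear0 !normr0 mulr0.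
have xp : 0 < `|x| by rewrite normr_gt0.
rewrite -ler_pdivrMr//; apply: sup_upper_bound; first exact: opnorm_has_sup.
exists (`|x|^-1 *: x); rewrite /= ?linearZ/= normrZ normfV normr_id.
  by rewrite mulVf// gt_eqF.
by rewrite mulrC.
Qed.

Lemma opnorm_le (f : clin) M :
  0 <= M -> (forall x, `|f x| <= M * `|x|) -> opnorm f <= M.
Proof.
move=> M0 fM; apply: ge_sup; first by case: (opnorm_has_sup f).
by move=> _ [x /= x1 <-]; rewrite (le_trans (fM x))// ler_piMr.
Qed.

Lemma opnormD (f g : clin) : opnorm (f + g) <= opnorm f + opnorm g.
Proof.
apply: opnorm_le => [|x]; first by rewrite addr_ge0 ?opnorm_ge0.
by rewrite clinDE (le_trans (ler_normD _ _))// mulrDl lerD ?opnormP.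
Qed.

Lemma opnormZ a (f : clin) : opnorm (a *: f) = `|a| * opnorm f.
Proof.
have le b (g : clin) : opnorm (b *: g) <= `|b| * opnorm g.
  apply: opnorm_le => [|x]; first by rewrite mulr_ge0 ?opnorm_ge0.
  by rewrite clinZE normrZ -mulrA ler_wpM2l ?opnormP.
have [->|a0] := eqVneq a 0.
  by apply/le_anti; rewrite le normr0 mul0r opnorm_ge0.
apply/le_anti; rewrite le /= -[f in X in X <= _]scale1r -(mulVf a0) -scalerA.
rewrite (le_trans (ler_wpM2l _ (le _ _)))// mulrA -normrM divff//.
by rewrite normr1 mul1r.
Qed.

Lemma opnorm_eq0 (f : clin) : opnorm f = 0 -> f = 0.
Proof.
move=> f0; apply/clin_eqP => x; apply/eqP; rewrite clin0E -normr_le0.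
by have := opnormP f x; rewrite f0 mul0r.
Qed.

HB.instance Definition _ :=
  Lmodule_isNormed.Build R clin opnormD opnormZ opnorm_eq0.

Lemma clin_normE (f : clin) : `|f| = opnorm f. Proof. by []. Qed.

End ContinuousLinear.

Arguments clin_pred {R} V W.

Notation dual X := (clin X (GRing.regular _)).

Section Duality.
Context {R : realType}.
Implicit Types X Y : normedModType R.

Lemma adjoint_subproof X Y (A : clin X Y) (l : dual Y) :
  l \o A \in clin_pred X R^o.
Proof.
rewrite inE; split=> [a x y|x] /=; first by rewrite !linearP.
by apply: continuous_comp; exact: clin_continuous.
Qed.

Definition adjoint X Y (A : clin X Y) (l : dual Y) : dual X :=
  Clin (adjoint_subproof A l).

Lemma bidual_subproof X (x : X) :
  (fun v : dual X => v x) \in clin_pred (dual X) R^o.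
Proof.
rewrite inE; pose e := fun v : dual X => v x; rewrite -/e.
have le : linear e by [].
pose E : {linear dual X -> R^o} :=
  HB.pack e (GRing.isLinear.Build _ _ _ _ _ le).
split=> //; apply: (@bounded_linear_continuous _ _ _ E).
apply/linear_boundedP; near=> r => v.
have xr : `|x| <= r by near: r; apply: nbhs_pinfty_ge; exact: num_real.
rewrite (le_trans (opnormP v x))// clin_normE mulrC.
by rewrite ler_wpM2r// opnorm_ge0.
Unshelve. all: by end_near. Qed.

Definition bidual_embedding X (x : X) : dual (dual X) :=
  Clin (bidual_subproof x).

Definition reflexive_space X : Prop :=
  forall phi : dual (dual X), exists x : X, bidual_embedding x = phi.

Definition separable_space (T : topologicalType) : Prop :=
  exists2 D : set T, countable D & dense D.

Definition weak_cvg X (u : nat -> X) (x : X) : Prop :=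
  forall v : dual X, v (u n) @[n --> \oo] --> v x.

Definition polar X (A : set X) : set (dual X) :=
  [set v | forall x, A x -> v x <= 0].

End Duality.

Section FrechetDerivative.
Context {R : realType} {X Y : normedModType R}.

(* The default [0] is used only where ['d G x] is not continuous, hence never
   where [G] is differentiable: see [fderivE]. *)
Definition fderiv (G : X -> Y) (x : X) : clin X Y := insubd 0 ('d G x : X -> Y).

Lemma fderivE (G : X -> Y) (x : X) :
  differentiable G x -> fderiv G x = 'd G x :> (X -> Y).
Proof.
move=> dG; rewrite /fderiv [LHS]val_insubd ifT// inE; split.
  exact: linearP.
exact: diff_continuous.
Qed.

(* The topology on [clin X Y] is that of the operator norm. *)
Definition continuously_differentiable (G : X -> Y) : Prop :=
  (forall x, differentiable G x) /\ continuous (fderiv G).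

End FrechetDerivative.

Section ConstraintSystem.
Context {R : realType} {X Y : normedModType R}.
Variables (G : X -> Y) (C : set X) (K : set Y).

Definition feasible_set : set X := [set x | C x /\ K (G x)].

Definition normal_cone (x : X) : set (dual X) :=
  [set v | C x /\ forall z, C z -> v (z - x) <= 0].

Definition M_set (x : X) (r : R) : set (dual X) :=
  [set v | exists (l : dual Y) (m : dual X),
    [/\ normal_cone x m,
        forall y, K y -> l (y - G x) <= r &
        v = adjoint (fderiv G x) l + m]].

Definition sAKKT_regular (xbar : X) : Prop :=
  forall vbar : dual X,
    (exists (x : nat -> X) (r : nat -> R) (v : nat -> dual X),
      [/\ x @ \oo --> xbar,
          forall k, 0 <= r k,
          r @ \oo --> 0,
          v @ \oo --> vbar &
          forall k, M_set (x k) (r k) (v k)]) ->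
    M_set xbar 0 vbar.

End ConstraintSystem.

Definition dist_to {R : realType} {Y : normedModType R} (K : set Y) (y : Y) : R :=
  inf [set `|y - z| | z in K].

Definition weak_tangent_cone {R : realType} {X : normedModType R}
    (F : set X) (xbar : X) : set X :=
  [set d | exists (x : nat -> X) (t : nat -> R),
    [/\ forall k, F (x k),
        forall k, 0 < t k,
        t @ \oo --> 0,
        x @ \oo --> xbar &
        weak_cvg (fun k => (t k)^-1 *: (x k - xbar)) d]].

Definition guignard_cq {R : realType} {X Y : normedModType R}
    (G : X -> Y) (C : set X) (K : set Y) (xbar : X) : Prop :=
  polar (weak_tangent_cone (feasible_set G C K) xbar) = M_set G C K xbar 0.

(* Main.v *)
(* The inclusion of M(xbar, 0) in the polar of the weak tangent cone is a direct
   estimate, using that weakly convergent sequences are bounded.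

   For the converse, let v be polar to the weak tangent cone. Weak sequential
   compactness of bounded sequences turns this into: for every e > 0,
   v (x - xbar) <= e |x - xbar| for feasible x near xbar. Minimise
     - v (x - xbar) + 2 e |x - xbar| + k d_K(G x)
   over C and a small ball, up to Ekeland's principle with slope e. As k grows
   the approximate minimisers accumulate weakly at a feasible point, which must
   be xbar by the slack 2 e versus e, and then convergence is strong. So for
   large k the minimiser x is interior to the ball; linearising G there and
   separating (Mazur-Orlicz on X * Y) gives w with |w| <= 3 e and
   v - w in M(x, 0). Since the regularity of xbar tolerates strong
   perturbations of v, this error needs no smooth renorming of X. *)
Require Import Defs.
From HB Require Import structures.
From mathcomp Require Import all_boot all_order all_algebra.
From mathcomp Require Import all_classical all_reals all_analysis.
From mathcomp Require Import lra ring.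

Set Implicit Arguments.
Unset Strict Implicit.
Unset Printing Implicit Defensive.

Import Order.TTheory GRing.Theory Num.Theory.
Import numFieldNormedType.Exports.

Local Open Scope classical_set_scope.
Local Open Scope ring_scope.

(** * Sublinear functionals and the Mazur-Orlicz theorem *)

Section Sublinear.
Context {R : realType} {E : lmodType R}.
Implicit Types (p q : E -> R) (S : set (E * R)).

(** Homogeneity is stated one-sidedly for [t > 0]; applying it to the inverse of [t] gives
    equality. *)
Definition sublinear p :=
  (forall x y, p (x + y) <= p x + p y) /\
  (forall t x, 0 < t -> p (t *: x) <= t * p x).

Lemma sublinear0 p : sublinear p -> p 0 = 0.
Proof.
move=> [_ pZ]; apply/le_anti.
have /= := pZ 2 0; have /= := pZ 2^-1 0; rewrite !scaler0; lra.
Qed.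

Lemma sublinearN p x : sublinear p -> - p (- x) <= p x.
Proof.
move=> sp; have := sp.1 x (- x); rewrite subrr (sublinear0 sp); lra.
Qed.

(** A pair [(x, r)] encodes the demand that a functional be at least [r] at [x]; such demands are
    stable under sums and positive multiples. *)
Definition is_cone S :=
  [/\ S (0, 0), forall a b, S a -> S b -> S (a.1 + b.1, a.2 + b.2) &
      forall t a, 0 < t -> S a -> S (t *: a.1, t * a.2)].

(* The largest sublinear function below p whose value at - a.1 is at most - a.2
   for all a in S. *)
Definition lowering p S x : R := inf [set p (x + a.1) - a.2 | a in S].

Section Lowering.
Variables (p : E -> R) (S : set (E * R)).
Hypotheses (sp : sublinear p) (cS : is_cone S).
Hypothesis Sp : forall a, S a -> a.2 <= p a.1.

(** This bound keeps the infimum in [lowering] finite. *)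
Let lb x a : S a -> - p (- x) <= p (x + a.1) - a.2.
Proof.
move=> /Sp; have := sp.1 (x + a.1) (- x); rewrite addrAC subrr add0r; lra.
Qed.

Lemma lowering_le x a : S a -> lowering p S x <= p (x + a.1) - a.2.
Proof.
move=> Sa; apply: ge_inf; last by exists a.
by exists (- p (- x)) => _ [b Sb <-]; exact: lb.
Qed.

Let le_lowering x r : (forall a, S a -> r <= p (x + a.1) - a.2) ->
  r <= lowering p S x.
Proof.
move=> h; apply: lb_le_inf; last by move=> _ [a Sa <-]; exact: h.
by case: cS => S0 _ _; exists (p (x + 0) - 0), (0, 0).
Qed.

Lemma lowering_le_fun x : lowering p S x <= p x.
Proof.
by have [S0 _ _] := cS; have := lowering_le x S0; rewrite addr0 subr0.
Qed.

Lemma sublinear_lowering : sublinear (lowering p S).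
Proof.
have [S0 SD SZ] := cS; split=> [x y|t x t0].
  rewrite -lerBlDr; apply: le_lowering => a Sa.
  rewrite lerBlDr -lerBlDl; apply: le_lowering => b Sb.
  have /= := lowering_le (x + y) (SD _ _ Sa Sb).
  have := sp.1 (x + a.1) (y + b.1); rewrite addrACA; lra.
rewrite -ler_pdivrMl//; apply: le_lowering => a Sa.
rewrite ler_pdivrMl// (le_trans (lowering_le _ (SZ _ _ t0 Sa)))//=.
by rewrite -scalerDr mulrBr lerD2r; exact: sp.2.
Qed.

End Lowering.

(** Zorn's lemma, ordered so that larger means pointwise smaller: a nonempty chain is bounded by its
    pointwise infimum, the empty one by [p]. *)
Lemma minimal_sublinear p : sublinear p ->
  exists q, [/\ sublinear q, (forall x, q x <= p x) &
    forall q', sublinear q' -> (forall x, q' x <= q x) -> q' = q].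
Proof.
move=> sp; pose T := {q : E -> R | sublinear q /\ forall x, q x <= p x}.
pose r (q q' : T) := `[< forall x, sval q' x <= sval q x >].
have [|||A totA|q qmin] := @Zorn T r.
- by move=> q; apply/asboolP.
- move=> q1 q2 q3 /asboolP h /asboolP k; apply/asboolP => x.
  exact: le_trans (k x) (h x).
- move=> [q1 h1] [q2 h2] /asboolP /= h /asboolP /= k; apply/eq_exist.
  by apply/funext => x; apply/le_anti; rewrite h k.
- have [[q0 Aq0]|A0] := pselect (A !=set0); last first.
    exists (exist _ p (conj sp (fun=> lexx _))) => s As.
    by exfalso; apply: A0; exists s.
  pose m x := inf [set sval q x | q in A].
  have mlb x : has_inf [set sval q x | q in A].
    split; first by exists (sval q0 x), q0.
    exists (- p (- x)) => _ [[q [sq qp]] Aq <-] /=.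
    by apply: le_trans (sublinearN _ sq); rewrite lerN2.
  have mle (q : T) x : A q -> m x <= sval q x.
    by move=> Aq; apply: ge_inf; [exact: (mlb x).2|exists q].
  have lem x c : (forall q : T, A q -> c <= sval q x) -> c <= m x.
    move=> h; apply: lb_le_inf; first exact: (mlb x).1.
    by move=> _ [q Aq <-]; exact: h.
  have sm : sublinear m.
    split=> [x y|t x t0].
      rewrite -lerBlDr; apply: (lem) => q Aq; rewrite lerBlDr -lerBlDl.
      apply: (lem) => q' Aq'; rewrite lerBlDl.
      (* The smaller of [q] and [q'] bounds [m] at [x + y], and it lies below the other one in the
         remaining term. *)
      have [/asboolP h|/asboolP h] := totA _ _ Aq Aq'.
        rewrite (le_trans (mle _ _ Aq'))// (le_trans ((svalP q').1.1 _ _))//.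
        by rewrite lerD2r.
      rewrite (le_trans (mle _ _ Aq))// (le_trans ((svalP q).1.1 _ _))//.
      by rewrite lerD2l.
    rewrite -ler_pdivrMl//; apply: (lem) => q Aq; rewrite ler_pdivrMl//.
    by rewrite (le_trans (mle _ _ Aq))//; exact: (svalP q).1.2.
  have mp x : m x <= p x.
    by rewrite (le_trans (mle _ _ Aq0))//; exact: (svalP q0).2.
  exists (exist _ m (conj sm mp)) => q Aq; apply/asboolP => x /=.
  exact: mle.
exists (sval q); split; [exact: (svalP q).1|exact: (svalP q).2|].
move=> q' sq' q'q.
have q'p x : q' x <= p x by rewrite (le_trans (q'q x))//; exact: (svalP q).2.
have := qmin (exist _ q' (conj sq' q'p)).
by move=> <- //; apply/asboolP.
Qed.

(* Lowering q along the ray of e yields q (- e) <= - q e unless q is minimal. *)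
Lemma minimal_sublinear_linear q : sublinear q ->
  (forall q', sublinear q' -> (forall x, q' x <= q x) -> q' = q) ->
  linear (q : E -> R^o).
Proof.
move=> sq qmin.
have qN e : q (- e) = - q e.
  apply/le_anti; rewrite andbC -[X in X && _]lerN2 opprK sublinearN//=.
  pose S := [set a : E * R | exists2 t, 0 <= t & a = (t *: e, t * q e)].
  have qZ t x : 0 <= t -> t * q x <= q (t *: x).
    rewrite le_eqVlt => /predU1P[<-|t0].
      by rewrite scale0r mul0r sublinear0.
    rewrite mulrC -ler_pdivlMr//.
    have := sq.2 t^-1 (t *: x).
    by rewrite invr_gt0 scalerA mulVf ?gt_eqF// scale1r mulrC; apply.
  have cS : is_cone S.
    split; first by exists 0 => //; rewrite scale0r mul0r.
      move=> _ _ [s s0 ->] [t t0 ->]; exists (s + t); first exact: addr_ge0.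
      by rewrite /= scalerDl mulrDl.
    move=> t _ t0 [s s0 ->]; exists (t * s); first by rewrite mulr_ge0// ltW.
    by rewrite /= scalerA mulrA.
  have Sq a : S a -> a.2 <= q a.1 by move=> [t t0 ->]; exact: qZ.
  rewrite -[in X in X <= _](qmin _ (sublinear_lowering sq cS Sq)); last first.
    by move=> x; exact: lowering_le_fun.
  have S1 : S (e, q e) by exists 1 => //; rewrite scale1r mul1r.
  by have := lowering_le sq Sq (- e) S1; rewrite /= addNr sublinear0// sub0r.
have qD x y : q (x + y) = q x + q y.
  apply/le_anti; rewrite sq.1/=.
  have := sq.1 (- x) (- y); rewrite -opprD !qN; lra.
have qZp t x : 0 < t -> q (t *: x) = t * q x.
  move=> t0; apply/le_anti; rewrite sq.2//=.
  by have := sq.2 _ (- x) t0; rewrite scalerN !qN mulrN lerN2.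
move=> a x y; rewrite qD; congr (_ + _).
have [a0|a0|->] := ltgtP a 0; last by rewrite !scale0r sublinear0.
  rewrite -[a]opprK scaleNr qN qZp ?oppr_gt0//.
  by rewrite scaleNr.
exact: qZp.
Qed.

(** A minimal sublinear function below [lowering p S] is linear, and [lowering p S (- a.1) <= - a.2]
    turns into [a.2 <= l a.1]. *)
Theorem mazur_orlicz p S : sublinear p -> is_cone S ->
  (forall a, S a -> a.2 <= p a.1) ->
  exists l : E -> R^o, [/\ linear l, (forall x, l x <= p x) &
    forall a, S a -> a.2 <= l a.1].
Proof.
move=> sp cS Sp.
have [l [sl lq lmin]] := minimal_sublinear (sublinear_lowering sp cS Sp).
have ll := minimal_sublinear_linear sl lmin.
exists l; split=> // [x|a Sa].
  exact: le_trans (lq x) (lowering_le_fun sp cS Sp x).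
have := lowering_le sp Sp (- a.1) Sa; rewrite addNr sublinear0// sub0r.
have := lq (- a.1).
have := sublinearN (- a.1) sl; rewrite opprK.
lra.
Qed.

End Sublinear.

Lemma mazur_orlicz_convex (R : realType) (E : lmodType R) (I : Type)
    (P : set I) (s : I -> E) (b : I -> R) (p : E -> R) :
  sublinear p -> P !=set0 ->
  (forall i j t, P i -> P j -> 0 <= t <= 1 -> exists k, [/\ P k,
     s k = t *: s i + (1 - t) *: s j & b k = t * b i + (1 - t) * b j]) ->
  (forall i, P i -> b i <= p (s i)) ->
  exists l : E -> R^o, [/\ linear l, (forall x, l x <= p x) &
    forall i, P i -> b i <= l (s i)].
Proof.
move=> sp [i0 Pi0] Pconv bp.
pose S := [set a : E * R | exists t i,
  [/\ 0 <= t, P i & a = (t *: s i, t * b i)]].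
have cS : is_cone S.
  split; first by exists 0, i0; rewrite scale0r mul0r.
    move=> _ _ [t [i [t0 Pi ->]]] [u [j [u0 Pj ->]]] /=.
    have [tu0|tu0] := eqVneq (t + u) 0.
      have -> : t = 0 by lra.
      have -> : u = 0 by lra.
      by exists 0, i; rewrite !scale0r !mul0r !addr0.
    have tup : 0 < t + u by rewrite lt_neqAle eq_sym tu0 addr_ge0.
    (* Normalising by [t + u] writes a sum of two multiples as one multiple of a convex
       combination. *)
    have [|k [Pk sk bk]] := Pconv i j (t / (t + u)) Pi Pj.
      by rewrite divr_ge0 ?(ltW tup)//= ler_pdivrMr// mul1r lerDl.
    have E1 : (t + u) * (t / (t + u)) = t by rewrite mulrC divfK.
    have E2 : (t + u) * (1 - t / (t + u)) = u by rewrite mulrBr mulr1 E1; ring.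
    exists (t + u), k; split=> //; first exact: ltW.
    rewrite sk bk scalerDr !scalerA E1 E2; congr (_, _).
    by rewrite mulrDr (mulrA (t + u) _ (b i)) (mulrA (t + u) _ (b j)) E1 E2.
  move=> t _ t0 [u [i [u0 Pi ->]]] /=; exists (t * u), i.
  by rewrite scalerA mulrA mulr_ge0// ltW.
have Sp a : S a -> a.2 <= p a.1.
  move=> [t [i [t0 Pi ->]]] /=; move: t0; rewrite le_eqVlt => /predU1P[<-|t0].
    by rewrite scale0r mul0r sublinear0.
  rewrite -ler_pdivlMl// (le_trans (bp i Pi))//.
  have := sp.2 t^-1 (t *: s i); rewrite invr_gt0 scalerA mulVf ?gt_eqF//.
  by rewrite scale1r; apply.
have [l [ll lp lS]] := mazur_orlicz sp cS Sp.
exists l; split=> // i Pi; apply: (lS (s i, b i)).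
by exists 1, i; rewrite scale1r mul1r.
Qed.

(** * Weak convergence in Banach spaces *)

Section BoundedLinear.
Context {R : realType}.
Implicit Types X Y : normedModType R.

Lemma bounded_linear_clin X Y (f : X -> Y) (M : R) :
  linear f -> (forall x, `|f x| <= M * `|x|) -> exists g : clin X Y, g =1 f.
Proof.
move=> lf fM.
pose F : {linear X -> Y} := HB.pack f (GRing.isLinear.Build _ _ _ _ _ lf).
have cf : continuous f.
  apply: (@bounded_linear_continuous _ _ _ F); apply/linear_boundedP.
  exists M; split; first exact: num_real.
  by move=> r Mr x; rewrite (le_trans (fM x))// ler_wpM2r// ltW.
have fP : f \in clin_pred X Y by rewrite inE.
by exists (Clin fP).
Qed.

Lemma dominated_linear_dual X (l : X -> R^o) (M : R) : 0 <= M -> linear l ->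
  (forall x, l x <= M * `|x|) -> exists2 g : dual X, `|g| <= M & g =1 l.
Proof.
move=> M0 ll lM.
pose L : {linear X -> R^o} := HB.pack l (GRing.isLinear.Build _ _ _ _ _ ll).
have lN x : l (- x) = - l x by exact: (linearN L).
have lM' x : `|l x : R^o| <= M * `|x|.
  by rewrite ler_norml lM andbT lerNl -lN -normrN lM.
have [g gl] := bounded_linear_clin ll lM'.
by exists g => //; rewrite clin_normE opnorm_le// => x; rewrite gl.
Qed.

Lemma dual_le X (v : dual X) x : v x <= `|v| * `|x|.
Proof. exact: le_trans (ler_norm _) (opnormP v x). Qed.

Lemma sublinear_norm X (M : R) : 0 <= M -> sublinear (fun x : X => M * `|x|).
Proof.
move=> M0; split=> [x y|t x t0]; first by rewrite -mulrDr ler_wpM2l// ler_normD.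
by rewrite normrZ gtr0_norm// mulrCA.
Qed.

(** Hahn-Banach, as Mazur-Orlicz with the norm as upper bound and a single demand at [x]. *)
Lemma norming_functional X (x : X) :
  exists2 v : dual X, `|v| <= 1 & v x = `|x|.
Proof.
have [|||l [ll lp lx]] := @mazur_orlicz_convex R X unit setT (fun=> x)
  (fun=> `|x|) _ (sublinear_norm X ler01).
- by exists tt.
- move=> _ _ t _ _ _; exists tt.
  by rewrite -scalerDl -mulrDl subrKC scale1r mul1r.
- by move=> _ _; rewrite mul1r.
have [v v1 vl] := dominated_linear_dual ler01 ll lp.
exists v => //; apply/le_anti; rewrite vl (lx tt)// andbT.
by rewrite (le_trans (lp x))// mul1r.
Qed.

Lemma convex_set_combination (E : lmodType R) (A : set E) a b t :
  convex_set A -> A a -> A b -> 0 <= t <= 1 -> A (t *: a + (1 - t) *: b).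
Proof.
move=> cA Aa Ab /andP[t0 t1].
by have := cA a b (Itv01 t0 t1) (mem_set Aa) (mem_set Ab); rewrite inE.
Qed.

(** A point outside [C] has distance at least some [e > 0] from [C]; separation gives [v] with
    [v x + e <= v c] on [C], which survives weak limits. *)
Lemma closed_convex_weakly_closed X (C : set X) (x_ : nat -> X) (x : X) :
  closed C -> convex_set C -> (forall k, C (x_ k)) -> weak_cvg x_ x -> C x.
Proof.
move=> clC cC Cx_ x_x; apply: contrapT => nCx.
have [e e0 eC] : exists2 e, 0 < e & forall c, C c -> e <= `|c - x|.
  have /nbhs_normP[e /= e0 xe] : nbhs x (~` C).
    by apply: open_nbhs_nbhs; split=> //; exact: closed_openC.
  exists e => // c Cc; rewrite leNgt; apply/negP => cx.
  by have := xe c; rewrite /ball_/= distrC => /(_ cx).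
have [|||l [ll lp lC]] := @mazur_orlicz_convex R X X C (fun c => c - x)
  (fun=> e) _ (sublinear_norm X ler01).
- by exists (x_ 0).
- move=> c d t Cc Cd t01; exists (t *: c + (1 - t) *: d); split.
  + exact: convex_set_combination.
  + by rewrite !scalerBr addrACA -opprD -scalerDl subrKC scale1r.
  + by rewrite -mulrDl subrKC mul1r.
- by move=> c Cc; rewrite mul1r eC.
have [v _ vl] := dominated_linear_dual ler01 ll lp.
have : v x + e <= v x.
  apply: (cvgr_to_ge (x_x v)); apply: nearW => k.
  by have := lC _ (Cx_ k); rewrite -vl linearB/= => h; rewrite addrC -lerBrDr.
by rewrite gerDl leNgt e0.
Qed.

End BoundedLinear.

(** * Weak limits from reflexivity and separability *)

Section WeakCompactness.
Context {R : realType}.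
Implicit Types X : normedModType R.

Lemma ultra_cvg_bounded (U : set_system nat) (f : nat -> R^o) (M : R) :
  UltraFilter U -> (forall k, `|f k| <= M) -> exists l : R^o, f @ U --> l.
Proof.
move=> UU fM.
have [|l [_ cl]] := @segment_compact R (- M) M (f @ U) _.
  change (U (f @^-1` `[- M, M]%classic)).
  by apply: filterS filterT => k _ /=; rewrite in_itv/= -ler_norml.
exists l => A Al; have [//|UnA] := in_ultra_setVsetC (f @^-1` A) UU.
by have [y [nAy Ay]] := cl (~` A) A UnA Al.
Qed.

(** The limits of [v (y k)] along [U] depend linearly and boundedly on [v], so they form an element
    of the bidual, which a point represents. *)
Lemma reflexive_ultralimit X (U : set_system nat) (y : nat -> X) (M : R) :
  reflexive_space X -> UltraFilter U -> (forall k, `|y k| <= M) ->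
  exists z : X, forall v : dual X, v (y k) @[k --> U] --> v z.
Proof.
move=> rX UU yM.
have vM (v : dual X) k : `|v (y k)| <= M * `|v|.
  by rewrite (le_trans (opnormP _ _))// clin_normE mulrC ler_wpM2r// opnorm_ge0.
have /choice[L Lcvg] (v : dual X) : exists l : R^o, v (y k) @[k --> U] --> l.
  exact: ultra_cvg_bounded (vM v).
have lL : linear L.
  move=> a u v; apply: (cvg_unique _ (Lcvg _)) => //.
  exact: (@cvgD _ R^o _ U _ (fun k => a *: (u (y k) : R^o)) (fun k => v (y k))
    _ _ (cvgZl_tmp (Lcvg u)) (Lcvg v)).
have LM v : `|L v| <= M * `|v|.
  apply: (cvgr_to_le (cvg_norm (Lcvg v))).
  by apply: nearW => k; exact: vM.
have [phi phiL] := bounded_linear_clin lL LM.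
have [z zphi] := rX phi.
by exists z => v; have := Lcvg v; rewrite -phiL -zphi.
Qed.

(** Take functionals norming a dense set. If all vanish at [a], a point [d] of that set near [a] has
    [|d| <= |d - a|], which is impossible for nonzero [a]. *)
Lemma separable_norming X : separable_space X ->
  exists w : nat -> dual X, forall a, (forall i, w i a = 0) -> a = 0.
Proof.
move=> [D /countable_injP[f finj] dD].
pose e n : X := get [set d | D d /\ f d = n].
have eD d : D d -> e (f d) = d.
  move=> Dd; have [De fe] : [set d' | D d' /\ f d' = f d] (e (f d)).
    by apply: getPex; exists d.
  by apply: finj => //; exact: mem_set.
have /choice[w wP] n : exists v : dual X, `|v| <= 1 /\ v (e n) = `|e n|.
  by have [v] := norming_functional (e n); exists v.
exists w => a wa0; apply/eqP/negPn/negP => a0.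
have a3 : 0 < `|a| / 3 by rewrite divr_gt0// normr_gt0.
have [d [ad Dd]] : ball a (`|a| / 3) `&` D !=set0.
  by apply: dD; [exists a; exact: ballxx|exact: ball_open].
have [w1 wd] := wP (f d).
rewrite eD// in wd.
have dle : `|d| <= `|d - a|.
  rewrite -wd -[X in X <= _]subr0 -(wa0 (f d)) -linearB.
  by rewrite (le_trans (dual_le _ _))// ler_piMl.
move: ad; rewrite -ball_normE /ball_/= => ad.
have := ler_normD (a - d) d; rewrite subrK.
have := distrC a d; lra.
Qed.

(* A weak limit z along one ultrafilter is identified by countably many norming
   functionals; a subsequence on which these converge to their values at z has
   z as weak limit along every ultrafilter, hence converges weakly to z. *)
Lemma weak_sequential_compactness X (x_ : nat -> X) (M : R) :
  reflexive_space X -> separable_space X -> (forall k, `|x_ k| <= M) ->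
  exists (s : nat -> nat) (z : X),
    (forall j, (j <= s j)%N) /\ weak_cvg (x_ \o s) z.
Proof.
move=> rX sX xM; have [w wsep] := separable_norming sX.
have [U [UU ooU]] := ultraFilterLemma (eventually_filter).
have [z Uz] := reflexive_ultralimit rX UU xM.
have near_z j n : U [set k | forall i, (i < n)%N ->
    `|w i z - w i (x_ k)| < j.+1%:R^-1].
  elim: n => [|n IHn]; first exact: filterS filterT.
  have : U [set k | `|w n z - w n (x_ k)| < j.+1%:R^-1].
    by have /cvgrPdist_lt := Uz (w n); apply; rewrite invr_gt0.
  apply: filterS2 IHn => k kn kwn i; rewrite ltnS leq_eqVlt.
  by move=> /predU1P[->//|]; exact: kn.
(* Finitely many conditions hold jointly on a set of [U]; demanding [j <= k] makes the selected
   indices tend to infinity. *)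
have /choice[s sP] j : exists k, (j <= k)%N /\
    forall i, (i < j.+1)%N -> `|w i z - w i (x_ k)| < j.+1%:R^-1.
  have Uj : U [set k | (j <= k)%N] by apply: ooU; exists j.
  have [k [kj kw]] := filter_ex (filterI Uj (near_z j j.+1)).
  by exists k.
have wcvg i : w i (x_ (s j)) @[j --> \oo] --> w i z.
  apply/cvgrPdist_lt => e e0.
  near=> j.
  have [_ /(_ i) h] := sP j.
  apply: (lt_trans (h _)).
    by near: j; exists i => // j /=.
  by near: j; exact: near_infty_natSinv_lt (PosNum e0).
exists s, z; split=> [j|v]; first by have [] := sP j.
apply/cvgrPdist_lt => e e0; apply: contrapT => nA.
pose A := [set j | `|v z - v (x_ (s j))| < e].
(* If convergence fails at [v], the violating indices carry a proper filter; an ultrafilter refining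
   it gives a weak limit that must again be [z]. *)
have pW : ProperFilter (within (~` A) \oo).
  apply: Build_ProperFilter_ex.
  move=> P PA; apply: contrapT => nP; apply: nA.
  apply: (@filterS _ \oo _ (fun j => (~` A) j -> P j) _ _ PA) => j jP.
  by apply: contrapT => Aj; apply: nP; exists j; exact: jP.
have [V [VV WV]] := ultraFilterLemma pW.
have ooV : \oo `<=` V by move=> B ooB; apply: WV; apply: filterS ooB => j Bj _.
have VnA : V (~` A) by apply: WV; exact: withinT.
have [z' Vz'] :=
  @reflexive_ultralimit _ _ (x_ \o s) M rX VV (fun j => xM (s j)).
have zz' : z' = z.
  apply/eqP; rewrite -subr_eq0; apply/eqP/wsep => i; rewrite linearB.
  apply/eqP; rewrite subr_eq0; apply/eqP.
  apply: (cvg_unique _ (Vz' (w i))) => //.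
  by apply: cvg_trans (wcvg i); exact: cvg_app.
have /cvgrPdist_lt/(_ _ e0) VA := Vz' v; rewrite zz' in VA.
by have [j [Aj nAj]] := filter_ex (filterI VA VnA).
Unshelve. all: by end_near. Qed.

End WeakCompactness.

(** * Completeness of operator spaces and uniform boundedness *)

Section DualComplete.
Context {R : realType} {X : normedModType R} {Y : completeNormedModType R}.

(** The pointwise limit is linear, and the Cauchy estimates pass to it uniformly relative to the
    norm of [x]. Completeness of [dual X] serves the uniform boundedness principle below. *)
Lemma clin_cauchy_cvg (F : set_system (clin X Y)) :
  ProperFilter F -> cauchy F -> cvg F.
Proof.
move=> FF cF.
have near_dist (e : R) : 0 < e -> exists f : clin X Y, F [set g | `|f - g| < e].
  move=> e0; have /cauchyP/(_ _ e0)[f Ff] := cF; exists f.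
  by apply: filterS Ff => g; rewrite -ball_normE.
have distE (f g : clin X Y) x : `|f x - g x| <= `|f - g| * `|x|.
  exact: (opnormP (f - g) x).
have /choice[L Lcvg] x : exists l : Y, (fun f : clin X Y => f x) @ F --> l.
  apply/cvg_ex; apply: cauchy_cvg; apply: cauchy_exP => e e0.
  have e1 : 0 < e / (`|x| + 1) by rewrite divr_gt0// ltr_wpDl.
  have [f Ff] := near_dist _ e1; exists (f x).
  change (F [set g : clin X Y | ball (f x) e (g x)]).
  apply: filterS Ff => g fg; rewrite /= -ball_normE /ball_/=.
  rewrite (le_lt_trans (distE _ _ _))//.
  have : `|f - g| * (`|x| + 1) < e by rewrite -ltr_pdivlMr// ltr_wpDl.
  by apply: le_lt_trans; rewrite ler_wpM2l// lerDl.
have lL : linear L.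
  move=> a x y; apply: (cvg_unique _ (Lcvg _)) => //.
  have -> : (fun f : clin X Y => f (a *: x + y)) = (fun f => a *: f x + f y).
    by apply/funext => f; rewrite linearP.
  exact: (@cvgD _ _ _ F _ (fun f : clin X Y => a *: f x)
    (fun f : clin X Y => f y) _ _ (cvgZl_tmp (Lcvg x)) (Lcvg y)).
have Ldist (f : clin X Y) (e : R) x :
    F [set g : clin X Y | `|f - g| < e] -> `|f x - L x| <= e * `|x|.
  move=> Ff.
  have h : (fun g : clin X Y => `|f x - g x|) @ F --> `|f x - L x|.
    by apply: cvg_norm; apply: cvgB; [exact: cvg_cst|exact: Lcvg].
  apply: (cvgr_to_le h).
  apply: filterS Ff => g fg; rewrite (le_trans (distE _ _ _))//.
  by rewrite ler_wpM2r// ltW.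
have [f0 Ff0] := near_dist 1 ltr01.
have LM x : `|L x| <= (`|f0| + 1) * `|x|.
  have := Ldist _ _ x Ff0; have := opnormP f0 x; rewrite -clin_normE.
  have := ler_distD (f0 x) 0 (L x); rewrite !sub0r !normrN; lra.
have [l lE] := bounded_linear_clin lL LM.
apply/cvg_ex; exists l; apply/(@cvgrPdist_lt _ _ _ F) => e e0.
have e2 : 0 < e / 2 by rewrite divr_gt0.
have [f Ff] := near_dist _ e2.
have fl : `|f - l| <= e / 2.
  rewrite clin_normE opnorm_le ?(ltW e2)// => x.
  by have := Ldist _ _ x Ff; rewrite -lE.
apply: filterS Ff => g /= fg.
by rewrite (le_lt_trans (ler_distD f l g))// (splitr e) ler_ltD// distrC.
Qed.

HB.instance Definition _ := Uniform_isComplete.Build (clin X Y) clin_cauchy_cvg.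

End DualComplete.

Section WeakBounded.
Context {R : realType}.
Implicit Types X : normedModType R.

(** Uniform boundedness applies to the evaluations at [x_ k] on [dual X]; norming functionals
    recover the norms of the points. *)
Lemma weak_cvg_bounded X (x_ : nat -> X) (x : X) :
  weak_cvg x_ x -> exists M, forall k, `|x_ k| <= M.
Proof.
move=> x_x.
pose F := range (fun k (v : dual X) => v (x_ k) : R^o).
have [|v|M hM] := @Banach_Steinhauss R (dual X) R^o F _ _ 1.
- move=> _ [k _ <-]; split=> // r; exists (r * `|x_ k|) => v vr.
  by rewrite (le_trans (opnormP _ _))// ler_wpM2r.
- have : cvgn (fun k => v (x_ k)) by apply/cvg_ex; exists (v x).
  move=> /cvg_seq_bounded/pinfty_ex_gt0[M _ hM].
  by exists M => _ [k _ <-]; exact: (hM k).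
exists M => k; have [v v1 vx] := norming_functional (x_ k).
rewrite -vx; apply: le_trans (ler_norm _) _.
by apply: (hM (fun v : dual X => v (x_ k)) _ v v1); exists k.
Qed.

End WeakBounded.

(** * Ekeland's principle and the distance function *)

(** [T x] collects the points improving on [x] with slope [e]. Successive near-minimisers over these
    nested sets form a Cauchy sequence, whose limit admits no strict improvement. *)
Lemma ekeland (R : realType) (X : completeNormedModType R) (S : set X)
    (phi : X -> R) (B e : R) (x0 : X) :
  closed S -> continuous phi -> (forall x, S x -> B <= phi x) -> 0 < e ->
  S x0 -> exists x, [/\ S x, phi x <= phi x0 &
    forall y, S y -> phi x <= phi y + e * `|y - x|].
Proof.
move=> clS cphi phiB e0 Sx0.
pose T x := [set y | S y /\ phi y + e * `|y - x| <= phi x].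
have /choice[f fP] (nx : nat * X) : exists y, S nx.2 ->
    T nx.2 y /\ forall z, T nx.2 z -> phi y <= phi z + nx.1.+1%:R^-1.
  case: nx => n x /=.
  have [Sx|nSx] := pselect (S x); last by exists x.
  have hi : has_inf [set phi y | y in T x].
    split; last by exists B => _ [y [Sy _] <-]; exact: phiB.
    by exists (phi x), x => //; split=> //; rewrite subrr normr0 mulr0 addr0.
  have n0 : 0 < n.+1%:R^-1 :> R by rewrite invr_gt0.
  have [_ [y Ty <-] yi] := inf_adherent n0 hi.
  exists y => _; split=> // z Tz; rewrite (le_trans (ltW yi))// lerD2r.
  by apply: ge_inf; [exact: hi.2|exists z].
pose u n := iteri n (fun k x => f (k, x)) x0.
have Su n : S (u n).
  by elim: n => [//|n IHn]; have [[]] := fP (n, u n) IHn.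
have Tle x y : T x y -> phi y <= phi x.
  by move=> [_]; apply: le_trans; rewrite lerDl mulr_ge0// ltW.
have Ttrans x y z : T x y -> T y z -> T x z.
  move=> [Sy xy] [Sz yz]; split=> //.
  have := ler_distD y z x.
  have := @ler_pM2l _ e e0 `|z - x| (`|z - y| + `|y - x|).
  by move=> <-; lra.
have Tu n m : (n <= m)%N -> T (u n) (u m).
  elim: m => [|m IHm].
    by rewrite leqn0 => /eqP ->; split=> //; rewrite subrr normr0 mulr0 addr0.
  rewrite leq_eqVlt => /predU1P[->|/IHm h].
    by split=> //; rewrite subrr normr0 mulr0 addr0.
  by apply: Ttrans h _; have [] := fP (m, u m) (Su m).
have uT n z : T (u n.+1) z -> phi (u n.+1) <= phi z + n.+1%:R^-1.
  move=> Tz; have [Tn h] := fP (n, u n) (Su n).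
  by apply: h; apply: Ttrans Tz.
(* On [T (u n.+1)] the function drops by at most [n.+1%:R^-1], so this set lies within
   [n.+1%:R^-1 / e] of [u n.+1]. *)
have cvgu : cvgn u.
  apply: cauchy_cvg; apply: cauchy_exP => r r0.
  have er0 : 0 < e * r by rewrite mulr_gt0.
  have [n _ nr] := near_infty_natSinv_lt (PosNum er0).
  exists (u n.+1); exists n.+1 => // m /= nm.
  have [_ h] := Tu _ _ nm; have k2 := uT _ _ (Tu _ _ nm).
  have /= k1 := nr n (leqnn n).
  rewrite -ball_normE /ball_; change (`|u n.+1 - u m| < r).
  rewrite distrC -(ltr_pM2l e0) (le_lt_trans _ k1)//.
  by rewrite -(lerD2l (phi (u m))); exact: le_trans h k2.
have /cvg_ex[x ux] := cvgu.
have Sx : S x by apply: (closed_cvg S clS _ _ ux); exact: nearW.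
have Tx n : T (u n) x.
  split=> //.
  have h : (fun m => phi (u m) + e * `|u m - u n|) @ \oo -->
      phi x + e * `|x - u n|.
    apply: cvgD; first exact: (cvg_comp _ _ ux (cphi x)).
    by apply: cvgMr; apply: cvg_norm; apply: cvgB => //; exact: cvg_cst.
  apply: (cvgr_to_le h).
  by exists n => // m /= nm; have [] := Tu _ _ nm.
exists x; split=> //.
  exact: Tle (Tx 0).
(* A violating [y] would lie in every [T (u n)], against near-minimality once [n.+1%:R^-1] is below
   [phi x - phi y]. *)
move=> y Sy; rewrite leNgt; apply/negP => yx.
have xy : phi y < phi x.
  by apply: le_lt_trans yx; rewrite lerDl mulr_ge0// ltW.
have Txy : T x y by split => //; exact: ltW.
have d0 : 0 < phi x - phi y by rewrite subr_gt0.
have [n _ nr] := near_infty_natSinv_lt (PosNum d0).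
have /= := nr n (leqnn n); rewrite ltrBrDl; apply/negP; rewrite -leNgt.
exact: le_trans (Tle _ _ (Tx n.+1)) (uT _ _ (Ttrans _ _ _ (Tx _) Txy)).
Qed.

Section Distance.
Context {R : realType} {Y : normedModType R} (K : set Y).
Hypothesis K0 : K !=set0.

Let dist_has_inf y : has_inf [set `|y - z| | z in K].
Proof.
split; first by have [z Kz] := K0; exists `|y - z|, z.
by exists 0 => _ [z _ <-].
Qed.

Lemma dist_to_le y z : K z -> dist_to K y <= `|y - z|.
Proof. by move=> Kz; apply: ge_inf; [exact: (dist_has_inf y).2|exists z]. Qed.

Lemma le_dist_to y r : (forall z, K z -> r <= `|y - z|) -> r <= dist_to K y.
Proof.
move=> h; apply: lb_le_inf; first exact: (dist_has_inf y).1.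
by move=> _ [z Kz <-]; exact: h.
Qed.

Lemma dist_to_ge0 y : 0 <= dist_to K y.
Proof. exact: le_dist_to. Qed.

Lemma dist_to_in y : K y -> dist_to K y = 0.
Proof.
move=> Ky; apply/le_anti; rewrite dist_to_ge0 andbT.
by rewrite (le_trans (dist_to_le _ Ky))// subrr normr0.
Qed.

Lemma dist_to_lipschitz y y' : dist_to K y <= dist_to K y' + `|y - y'|.
Proof.
rewrite -lerBlDr; apply: le_dist_to => z Kz; rewrite lerBlDr addrC.
by rewrite (le_trans (dist_to_le y Kz))// ler_distD.
Qed.

Lemma continuous_dist_to : continuous (dist_to K).
Proof.
move=> y; apply/cvgrPdist_le => e e0; near=> z.
have yz : `|y - z| <= e.
  by near: z; apply: cvgr_dist_le.
have := dist_to_lipschitz y z; have := dist_to_lipschitz z y.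
rewrite (distrC z y) ler_norml; lra.
Unshelve. all: by end_near. Qed.

End Distance.

(** Otherwise violating points tend to [xbar]; a selection of their normalised differences has a
    weak limit [z], which is tangent with [v z >= e]. *)
Lemma polar_weak_tangent_cone (R : realType) (X : normedModType R) (F : set X)
    (xbar : X) (v : dual X) (e : R) :
  reflexive_space X -> separable_space X ->
  polar (weak_tangent_cone F xbar) v -> 0 < e ->
  exists2 d : R, 0 < d & forall x, F x -> `|x - xbar| <= d ->
    v (x - xbar) <= e * `|x - xbar|.
Proof.
move=> rX sX vF e0; apply: contrapT => nd.
have /choice[x xP] n : exists x, [/\ F x, `|x - xbar| <= n.+1%:R^-1 &
    e * `|x - xbar| < v (x - xbar)].
  apply: contrapT => nx; apply: nd; exists n.+1%:R^-1 => [|x Fx xn].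
    by rewrite invr_gt0.
  by rewrite leNgt; apply/negP => vx; apply: nx; exists x.
pose t n := `|x n - xbar|.
have t0 n : 0 < t n.
  rewrite /t normr_gt0; apply/eqP => h; have [_ _] := xP n.
  by rewrite h normr0 mulr0 linear0 ltxx.
have d1 n : `|(t n)^-1 *: (x n - xbar)| <= 1.
  by rewrite normrZ gtr0_norm ?invr_gt0// mulVf// gt_eqF.
have [s [z [sj sz]]] := weak_sequential_compactness rX sX d1.
have tsj j : t (s j) <= j.+1%:R^-1.
  have [_ h _] := xP (s j); rewrite (le_trans h)// lef_pV2 ?posrE//.
  by rewrite ler_nat ltnS.
have ts0 : t \o s @ \oo --> (0 : R).
  apply/cvgrPdist_lt => r r0; near=> j.
  rewrite sub0r normrN gtr0_norm//= (le_lt_trans (tsj j))//.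
  by near: j; exact: near_infty_natSinv_lt (PosNum r0).
have : weak_tangent_cone F xbar z.
  exists (x \o s), (t \o s); split=> //.
  - by move=> k; have [] := xP (s k).
  - by move=> k; exact: t0.
  apply/cvgrPdist_lt => r r0; move/cvgrPdist_lt : ts0 => /(_ _ r0).
  apply: filterS => j; rewrite sub0r normrN /t /= distrC.
  by rewrite ger0_norm.
move=> /vF; apply/negP; rewrite -ltNge (lt_le_trans e0)//.
apply: (cvgr_to_ge (sz v)); apply: nearW => k /=.
rewrite linearZ/= -[X in _ <= X]mulrC ler_pdivlMr//.
by have [_ _ /ltW] := xP (s k).
Unshelve. all: by end_near. Qed.

(** * Multipliers for the penalised problem *)

Section Multipliers.
Context {R : realType} {X Y : normedModType R}.
Variables (G : X -> Y) (C : set X) (K : set Y).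

Lemma fderiv_approx (x : X) (e : R) : differentiable G x -> 0 < e ->
  exists2 d : R, 0 < d & forall h, `|h| <= d ->
    `|G (x + h) - G x - fderiv G x h| <= e * `|h|.
Proof.
move=> dG e0.
have /eqaddoP/(_ _ e0)/nbhs_normP[d /= d0 hd] := diff_locally dG.
exists (d / 2) => [|h hd2]; first by rewrite divr_gt0.
have := hd h; rewrite /ball_/= sub0r normrN.
rewrite fderivE// -addrA -opprD (addrC x h); apply.
by rewrite (le_lt_trans hd2)// ltr_pdivrMr// ltr_pMr// ltr1n.
Qed.

(** For feasible [x + h] both [m h] and [l (G (x + h) - G x)] are nonpositive, so only the
    linearisation error counts; divided by [t k] it is arbitrarily small, since weakly convergent
    quotients are bounded. *)
Lemma M_set_polar_tangent (x : X) (v : dual X) :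
  differentiable G x -> M_set G C K x 0 v ->
  polar (weak_tangent_cone (feasible_set G C K) x) v.
Proof.
move=> dG [l [m [[_ mC] lK ->]]] d [x_ [t [Fx t0 _ x_x qd]]].
have [M qM] := weak_cvg_bounded qd.
have M0 : 0 <= M by exact: le_trans (qM 0).
have lM0 : 0 < `|l| * M + 1 by rewrite ltr_wpDl// mulr_ge0.
apply/ler_addgt0Pr => e e0; rewrite add0r.
have e1 : 0 < e / (`|l| * M + 1) by rewrite divr_gt0.
have [r r0 hr] := fderiv_approx dG e1.
apply: (cvgr_to_le (qd _)).
have /cvgrPdist_le/(_ _ r0) := x_x.
apply: filterS => k; rewrite distrC => xr.
have [Cx Kx] := Fx k.
set h := x_ k - x in xr *.
have hq : h = t k *: ((t k)^-1 *: h) by rewrite scalerA mulfV ?gt_eqF// scale1r.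
rewrite linearZ; change ((t k)^-1 * (l (fderiv G x h) + m h) <= e).
rewrite ler_pdivrMl//.
have mh : m h <= 0 by exact: mC.
have lh : l (G (x + h) - G x) <= 0 by rewrite /h subrKC; exact: lK.
have := dual_le l (- (G (x + h) - G x - fderiv G x h)).
rewrite normrN linearN linearB/=.
have := hr _ xr.
set D := `|_ - _| => D1 D2.
suff : `|l| * D <= t k * e by lra.
have : `|h| <= t k * M.
  by rewrite hq normrZ gtr0_norm// ler_wpM2l// ltW.
move=> hM; rewrite (le_trans (ler_wpM2l (normr_ge0 l) D1))//.
rewrite mulrA (le_trans (ler_wpM2l (mulr_ge0 (normr_ge0 l) (ltW e1)) hM))//.
set c := _ + 1 in e1 lM0 *.
have -> : `|l| * (e / c) * (t k * M) = t k * (`|l| * M * e / c) by ring.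
rewrite ler_wpM2l ?(ltW (t0 k))// ler_pdivrMr// mulrC ler_wpM2l ?(ltW e0)//.
by rewrite lerDl.
Qed.

(** The penalised inequality is used at a point [x + t *: h] of the segment from [x] to [c], then
    divided by [t]. *)
Lemma penalty_linearized (x : X) (v : dual X) (a k r : R) :
  differentiable G x -> C x -> convex_set C -> K !=set0 -> convex_set K ->
  0 <= k -> 0 < r ->
  (forall c, C c -> `|c - x| <= r ->
     v (c - x) <= a * `|c - x| + k * (dist_to K (G c) - dist_to K (G x))) ->
  forall c y, C c -> K y ->
    v (c - x) + k * dist_to K (G x) <=
    a * `|c - x| + k * `|G x + fderiv G x (c - x) - y|.
Proof.
move=> dG Cx cC K0 cK k0 r0 vx c y Cc Ky.
set h := c - x; set p := G x; set A := fderiv G x; set d := dist_to K p.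
apply/ler_addgt0Pr => e e0.
have kh0 : 0 < k * `|h| + 1 by rewrite ltr_wpDl// mulr_ge0.
have e1 : 0 < e / (k * `|h| + 1) by rewrite divr_gt0.
have [s s0 hs] := fderiv_approx dG e1.
have h0 : 0 < `|h| + 1 by rewrite ltr_wpDl.
have [t [t0 t1 tr ts]] :
    exists t, [/\ 0 < t, t < 1, t * `|h| <= r & t * `|h| <= s].
  (* The minimum keeps [x + t *: h] within the radius [r] and within reach [s] of the linearisation;
     [2^-1] ensures [0 < 1 - t]. *)
  pose t := Num.min 2^-1 (Num.min r s / (`|h| + 1)).
  have rs0 : 0 < Num.min r s by rewrite lt_min r0.
  have th : t * `|h| <= Num.min r s.
    have : t * (`|h| + 1) <= Num.min r s.
      by rewrite -ler_pdivlMr// ge_min lexx orbT.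
    have : 0 <= t by rewrite le_min invr_ge0 ler0n divr_ge0// ltW.
    by rewrite mulrDr mulr1; lra.
  exists t; split; first by rewrite lt_min invr_gt0 ltr0n divr_gt0.
  - by rewrite gt_min invf_lt1 ?ltr1n.
  - by rewrite (le_trans th)// ge_min lexx.
  - by rewrite (le_trans th)// ge_min lexx orbT.
have nth : `|t *: h| = t * `|h| by rewrite normrZ gtr0_norm.
have t01 : 0 <= t <= 1 by rewrite !ltW.
have Cxt : C (x + t *: h).
  have := convex_set_combination cC Cc Cx t01.
  by rewrite scalerBl scale1r addrCA -scalerBr.
have vxt : t * v h <= a * (t * `|h|) + k * (dist_to K (G (x + t *: h)) - d).
  by have := vx _ Cxt; rewrite [x + _]addrC addrK nth linearZ => /(_ tr).
(* The point [t *: y + (1 - t) *: z] of [K] bounds the distance; the infimum over [z] yields the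
   term [(1 - t) * d]. *)
have : dist_to K (G (x + t *: h)) <=
    e / (k * `|h| + 1) * (t * `|h|) + t * `|p + A h - y| + (1 - t) * d.
  set E := _ * (t * _).
  have t10 : 0 < 1 - t by rewrite subr_gt0.
  rewrite -lerBlDl -ler_pdivrMl//; apply: le_dist_to => // z Kz.
  rewrite ler_pdivrMl// lerBlDl.
  have := dist_to_le K0 (G (x + t *: h)) (convex_set_combination cK Ky Kz t01).
  move/le_trans; apply.
  have -> : G (x + t *: h) - (t *: y + (1 - t) *: z) =
      (G (x + t *: h) - p - A (t *: h)) +
      t *: (p + A h - y) + (1 - t) *: (p - z).
    have -> : G (x + t *: h) - p - A (t *: h) = G (x + t *: h) - (p + t *: A h).
      by rewrite opprD addrA linearZ.
    rewrite -addrA.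
    have -> : t *: (p + A h - y) + (1 - t) *: (p - z) =
        (p + t *: A h) - (t *: y + (1 - t) *: z).
      rewrite !scalerBr scalerDr addrACA -opprD (addrAC (t *: p)) -scalerDl.
      by rewrite subrKC scale1r.
    by rewrite addrA subrK.
  rewrite (le_trans (ler_normD _ _))// normrZ gtr0_norm// lerD2r.
  rewrite (le_trans (ler_normD _ _))// normrZ gtr0_norm// lerD2r.
  by have := hs (t *: h); rewrite nth; exact.
move=> /(ler_wpM2l k0).
move: vxt; set d' := dist_to _ _; set N := `|p + _ - _|; set H := `|h|.
have : t * (k * (e / (k * H + 1)) * H) <= t * e.
  rewrite ler_wpM2l ?(ltW t0)//.
  have -> : k * (e / (k * H + 1)) * H = k * H * e / (k * H + 1) by ring.
  by rewrite ler_pdivrMr// mulrC ler_wpM2l ?(ltW e0)// lerDl.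
rewrite -[_ + k * d <= _](ler_pM2l t0); lra.
Qed.


(** Separation on [X * Y] below the weighted sum [q] of the norms yields a functional whose
    components are the error [w] and the multiplier [m]. *)
Lemma linearized_multiplier (x : X) (v : dual X) (a k : R) :
  C x -> convex_set C -> K !=set0 -> convex_set K -> 0 <= a -> 0 < k ->
  (forall c y, C c -> K y -> v (c - x) + k * dist_to K (G x) <=
    a * `|c - x| + k * `|G x + fderiv G x (c - x) - y|) ->
  exists2 w : dual X, `|w| <= a & M_set G C K x 0 (v - w).
Proof.
move=> Cx cC K0 cK a0 k0 vx.
set p := G x in vx *; set A := fderiv G x in vx *; set d := dist_to K p in vx *.
pose q (u : X * Y) := a * `|u.1| + k * `|u.2|.
have sq : sublinear q.
  have [h1 h2] := sublinear_norm X a0.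
  have [h3 h4] := sublinear_norm Y (ltW k0).
  split=> [u u'|t u t0] /=.
    by have := h1 u.1 u'.1; have := h3 u.2 u'.2; rewrite /q/=; lra.
  by have := h2 t u.1 t0; have := h4 t u.2 t0; rewrite /q/=; lra.
have [|||l [ll lq lv]] := @mazur_orlicz_convex R (X * Y)%type (X * Y)%type
  (C `*` K) (fun i => (i.1 - x, p + A (i.1 - x) - i.2))
  (fun i => v (i.1 - x) + k * d) q sq.
- by have [y Ky] := K0; exists (x, y).
- move=> [c y] [c' y'] t [/= Cc Ky] [/= Cc' Ky'] t01.
  have cE : t *: c + (1 - t) *: c' - x = t *: (c - x) + (1 - t) *: (c' - x).
    by rewrite !scalerBr addrACA -opprD -scalerDl subrKC scale1r.
  exists (t *: c + (1 - t) *: c', t *: y + (1 - t) *: y'); split => /=.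
  + by split; exact: convex_set_combination.
  + rewrite cE; congr (_, _); rewrite linearD !linearZ/= !scalerBr !scalerDr.
    by rewrite [RHS]addrACA -opprD [in RHS]addrACA -scalerDl subrKC scale1r.
  + have -> : v (t *: c + (1 - t) *: c' - x) =
        t * v (c - x) + (1 - t) * v (c' - x).
      by rewrite cE linearD !linearZ.
    ring.
- by move=> [c y] [/= Cc Ky]; exact: vx.
have l1 : linear (fun h : X => l (h, 0)).
  move=> t h h'; rewrite -ll; congr (l _); congr (_, _).
  by rewrite /= scaler0 addr0.
have l2 : linear (fun z : Y => l (0, z)).
  move=> t h h'; rewrite -ll; congr (l _); congr (_, _).
  by rewrite /= scaler0 addr0.
have lE h z : l (h, z) = l (h, 0) + l (0, z).
  rewrite -[X in X + _]scale1r -ll scale1r; congr (l _); congr (_, _) => /=.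
    by rewrite addr0.
  by rewrite add0r.
have [|w wa wE] := dominated_linear_dual a0 l1.
  by move=> h; rewrite (le_trans (lq _))// /q/= normr0 mulr0 addr0.
have [|m mk mE] := dominated_linear_dual (ltW k0) l2.
  by move=> h; rewrite (le_trans (lq _))// /q/= normr0 mulr0 add0r.
have main c y : C c -> K y ->
    v (c - x) + k * d <= w (c - x) + m (A (c - x)) + m (p - y).
  move=> Cc Ky; have /= := lv (c, y) (conj Cc Ky).
  by rewrite lE -wE -mE (addrC p) -addrA (linearD m) addrA.
exists w => //; exists m, (v - w - adjoint A m).
split; last by rewrite [RHS]addrC subrK.
- split=> // c Cc.
  set h := c - x; change (v h - w h - m (A h) <= 0).
  set u := _ - m _.
  (* With [m (p - y) <= k * |p - y|], [main] bounds every distance from [p] to points of [K] below,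
     hence also [d], and [d] cancels. *)
  suff : k^-1 * u + d <= d by rewrite gerDr pmulr_rle0// invr_gt0.
  apply: le_dist_to => // y Ky.
  rewrite -(ler_pM2l k0) mulrDr mulrA mulfV ?gt_eqF// mul1r.
  have := main c y Cc Ky; have := dual_le m (p - y).
  by have := ler_wpM2r (normr_ge0 (p - y)) mk; rewrite -/h /u; lra.
- move=> y Ky.
  (* Taking [c = x] leaves [k * d <= m (p - y)]: the sign condition is exact even when [G x] lies
     outside [K]. *)
  have := main x y Cx Ky; rewrite subrr !linear0 !add0r => h.
  rewrite -opprB linearN/= oppr_le0 (le_trans _ h)// mulr_ge0 ?(ltW k0)//.
  exact: dist_to_ge0.
Qed.

End Multipliers.

(** * Penalisation and the constraint qualification *)

Lemma approximate_multiplier (R : realType) (X Y : completeNormedModType R)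
    (G : X -> Y) (C : set X) (K : set Y) (xbar : X) (v : dual X) (e : R) :
  (forall x, differentiable G x) ->
  closed C -> convex_set C -> K !=set0 -> convex_set K ->
  reflexive_space X -> separable_space X -> feasible_set G C K xbar ->
  (forall (x_ : nat -> X) (x : X),
      (forall k, C (x_ k)) -> C x ->
      weak_cvg x_ x -> dist_to K (G (x_ k)) @[k --> \oo] --> 0 ->
      K (G x)) ->
  polar (weak_tangent_cone (feasible_set G C K) xbar) v -> 0 < e ->
  exists x w, [/\ `|x - xbar| <= e, `|w| <= 3 * e & M_set G C K x 0 (v - w)].
Proof.
move=> dG clC cC K0 cK rX sX [Cxbar Kxbar] Gw vT e0.
have [d d0 vd] := polar_weak_tangent_cone rX sX vT e0.
pose S := [set x | C x /\ `|x - xbar| <= d].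
have cdist : continuous (fun x : X => `|x - xbar|).
  by move=> x; apply: cvg_norm; apply: cvgB; [exact: cvg_id|exact: cvg_cst].
have clS : closed S.
  apply: closedI => //.
  apply: (@closed_comp _ _ (fun x => `|x - xbar|) [set r : R | r <= d]).
    by move=> x _; exact: cdist.
  exact: closed_le.
pose phi n x :=
  - v (x - xbar) + (2 * e * `|x - xbar| + n.+1%:R * dist_to K (G x)).
have cphi n : continuous (phi n).
  move=> x; apply: cvgD.
    apply: cvgN.
    apply: (cvg_comp (fun x => x - xbar) v); last exact: clin_continuous.
    by apply: cvgB; [exact: cvg_id|exact: cvg_cst].
  apply: cvgD; first by apply: cvgMr; exact: cdist.
  apply: cvgMr.
  apply: (cvg_comp G (dist_to K) (differentiable_continuous (dG x))).
  exact: continuous_dist_to.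
have vS x : S x -> v (x - xbar) <= `|v| * d.
  by move=> [_ xd]; rewrite (le_trans (dual_le _ _))// ler_wpM2l.
have phiB n x : S x -> - (`|v| * d) <= phi n x.
  move=> /vS Sx; rewrite /phi.
  have : 0 <= n.+1%:R * dist_to K (G x) by rewrite mulr_ge0// dist_to_ge0.
  have : 0 <= 2 * e * `|x - xbar| by rewrite !mulr_ge0// ltW.
  lra.
have Sxbar : S xbar by split=> //; rewrite subrr normr0 ltW.
have phi0 n : phi n xbar = 0.
  by rewrite /phi subrr linear0 normr0 dist_to_in// !mulr0 oppr0 !addr0.
(* Starting at [xbar], where [phi n] vanishes, ensures [phi n (u n) <= 0]. *)
have /choice[u uP] n := ekeland clS (cphi n) (phiB n) e0 Sxbar.
have Su n : S (u n) by have [] := uP n.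
have Cu n : C (u n) by have [] := Su n.
have ud n : `|u n - xbar| <= d by have [] := Su n.
have uphi n :
    2 * e * `|u n - xbar| + n.+1%:R * dist_to K (G (u n)) <= v (u n - xbar).
  by have [_ + _] := uP n; rewrite phi0 /phi addrC subr_le0.
have uv n : 2 * e * `|u n - xbar| <= v (u n - xbar).
  rewrite (le_trans _ (uphi n))// lerDl mulr_ge0// dist_to_ge0//.
have udist n : dist_to K (G (u n)) <= (`|v| * d) / n.+1%:R.
  rewrite ler_pdivlMr// mulrC (le_trans _ (vS _ (Su n)))//.
  by rewrite (le_trans _ (uphi n))// lerDr !mulr_ge0// ltW.
have [n [un_d un_e]] : exists n, `|u n - xbar| < d /\ `|u n - xbar| <= e.
  apply: contrapT => nu.
  have ur n : Num.min d e <= `|u n - xbar|.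
    rewrite leNgt; apply/negP; rewrite lt_min => /andP[h1 h2].
    by apply: nu; exists n; split => //; exact: ltW.
  have uM k : `|u k| <= d + `|xbar|.
    by rewrite -[u k](subrK xbar) (le_trans (ler_normD _ _))// lerD2r.
  have [s [z [sj sz]]] := weak_sequential_compactness rX sX uM.
  have Cz : C z.
    by apply: (closed_convex_weakly_closed clC cC _ sz) => k; exact: Cu.
  have szB (w : dual X) : w (u (s j) - xbar) @[j --> \oo] --> w (z - xbar).
    have -> : (fun j => w (u (s j) - xbar)) = (fun j => w (u (s j)) - w xbar).
      by apply/funext => j; rewrite linearB.
    by rewrite linearB; apply: cvgB; [exact: sz|exact: cvg_cst].
  have Kz : K (G z).
    apply: (Gw _ _ _ Cz sz) => [k|]; first exact: Cu.
    apply/cvgrPdist_lt => r r0.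
    have vd0 : 0 < `|v| * d + 1 by rewrite ltr_wpDl// mulr_ge0// ltW.
    have rv : 0 < r / (`|v| * d + 1) by rewrite divr_gt0.
    near=> j; rewrite sub0r normrN ger0_norm ?dist_to_ge0//.
    rewrite (le_lt_trans (udist _))//=.
    have h : j.+1%:R^-1 < r / (`|v| * d + 1).
      by near: j; exact: near_infty_natSinv_lt (PosNum rv).
    rewrite ltr_pdivlMr// in h; apply: le_lt_trans h; rewrite mulrC ler_pM//.
    - by rewrite mulr_ge0// ltW.
    - by rewrite lef_pV2 ?posrE// ler_nat ltnS.
    - by rewrite lerDl.
  (* A functional norming [z - xbar] supplies weak lower semicontinuity of the norm. *)
  have [w w1 wz] := norming_functional (z - xbar).
  have wle x : w x <= `|x|.
    by rewrite (le_trans (dual_le _ _))// ler_piMl.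
  have zd : `|z - xbar| <= d.
    rewrite -wz; apply: (cvgr_to_le (szB w)); apply: nearW => j.
    exact: le_trans (wle _) (ud _).
  have := vd z (conj Cz Kz) zd.
  have : 2 * e * `|z - xbar| <= v (z - xbar).
    rewrite -wz -subr_ge0.
    apply: (@cvgr_to_ge _ \oo _ _
      (fun j => v (u (s j) - xbar) - 2 * e * w (u (s j) - xbar))).
      by apply: cvgB; [exact: szB|apply: cvgMr; exact: szB].
    apply: nearW => j; rewrite subr_ge0 (le_trans _ (uv _))//.
    by rewrite ler_pM2l ?mulr_gt0.
  move=> h1 h2.
  have zx : z - xbar = 0.
    apply/normr0_eq0/le_anti; rewrite normr_ge0 andbT -(ler_pM2l e0) mulr0; lra.
  (* Minimisers staying away from [xbar] would keep [v (u n - xbar)] above a positive constant,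
     although its limit along [s] is [v 0]. *)
  have me : 0 < 2 * e * Num.min d e by rewrite !mulr_gt0// lt_min d0.
  have : 2 * e * Num.min d e <= v (z - xbar).
    apply: (cvgr_to_ge (szB v)); apply: nearW => j.
    by rewrite (le_trans _ (uv _))// ler_pM2l// mulr_gt0.
  by rewrite zx linear0 leNgt me.
have [_ _ umin] := uP n; set x := u n in un_d un_e umin *.
have r0 : 0 < d - `|x - xbar| by rewrite subr_gt0.
have k0 : 0 < n.+1%:R :> R by [].
(* The factor 3 adds Ekeland's slope [e] to the slope [2 * e] of the norm term; the radius keeps [c]
   in the ball. *)
have vx c : C c -> `|c - x| <= d - `|x - xbar| -> v (c - x) <=
    3 * e * `|c - x| + n.+1%:R * (dist_to K (G c) - dist_to K (G x)).
  move=> Cc cx.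
  have tri : `|c - xbar| <= `|c - x| + `|x - xbar| by exact: ler_distD.
  have Sc : S c by split=> //; rewrite (le_trans tri)// -lerBrDr.
  have := umin c Sc; rewrite /phi.
  have -> : v (c - x) = v (c - xbar) - v (x - xbar).
    by rewrite -linearB opprB addrA subrK.
  have : e * `|c - xbar| <= e * (`|c - x| + `|x - xbar|) by rewrite ler_pM2l.
  lra.
have [w we wM] := linearized_multiplier (Cu n) cC K0 cK
  (mulr_ge0 (ler0n R 3) (ltW e0)) k0
  (penalty_linearized (dG x) (Cu n) cC K0 cK (ltW k0) r0 vx).
by exists x, w.
Unshelve. all: by end_near. Qed.

Theorem theorem5p12 (R : realType) (X Y : completeNormedModType R)
    (G : X -> Y) (C : set X) (K : set Y)
    (G_C1 : continuously_differentiable G)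
    (C_nonempty : C !=set0) (C_closed : closed C) (C_convex : convex_set C)
    (K_nonempty : K !=set0) (K_closed : closed K) (K_convex : convex_set K)
    (X_reflexive : reflexive_space X) (X_separable : separable_space X)
    (xbar : X) (xbar_feasible : feasible_set G C K xbar)
    (xbar_regular : sAKKT_regular G C K xbar)
    (G_weakly_closed : forall (x_ : nat -> X) (x : X),
      (forall k, C (x_ k)) -> C x ->
      weak_cvg x_ x -> dist_to K (G (x_ k)) @[k --> \oo] --> 0 ->
      K (G x)) :
  guignard_cq G C K xbar.
Proof.
have [dG cG] := G_C1.
apply/seteqP; split=> [v vT|v]; last exact: M_set_polar_tangent.
apply: xbar_regular.
have n0 n : 0 < n.+1%:R^-1 :> R by rewrite invr_gt0.
have /choice[x /choice[w xwP]] n := approximate_multiplier dG C_closed C_convex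
  K_nonempty K_convex X_reflexive X_separable xbar_feasible G_weakly_closed vT
  (n0 n).
(* The tolerances are zero; the errors [w n], of norm at most [3 * n.+1%:R^-1], are absorbed by the
   strong convergence to [v]. *)
exists x, (fun=> 0), (fun n => v - w n); split=> //.
- apply/cvgrPdist_le => e e0; near=> n.
  have [h _ _] := xwP n; rewrite distrC (le_trans h)// ltW//.
  by near: n; exact: near_infty_natSinv_lt (PosNum e0).
- exact: cvg_cst.
- apply/cvgrPdist_le => e e0; near=> n.
  have [_ h _] := xwP n; rewrite subKr (le_trans h)// -ler_pdivlMl// ltW//.
  near: n.
  have e3 : 0 < 3^-1 * e by rewrite mulr_gt0// invr_gt0.
  exact: near_infty_natSinv_lt (PosNum e3).
- by move=> k; have [] := xwP k.
Unshelve. all: by end_near. Qed.
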